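(* The family of distance-$d$ parity codes has a code-capacity threshold of $50\%$ under an optimal decoder. That is, let $P_{\mathrm{fail}}(d,p)$ denote the probability that the optimal decoder fails on the distance-$d$ parity code when each qubit is flipped independently with probability $p$ and stabilizer measurements are noiseless. Then $$\sup\{q\in[0,1] : \lim_{d\to\infty}P_{\mathrm{fail}}(d,p)=0\ \text{ for all } 0\le p<q\}=\tfrac12 .$$
   Context: Parity code (LHZ layout), combinatorial description: the distance-$d$ parity code has $n=d(d+1)/2$ physical qubits and $d+1$ qubit lines (1-lines), labelled $0,1,\dots,d$. Each qubit line is a set of $d$ qubits, every two distinct qubit lines have exactly one qubit in common, and every qubit lies on exactly two qubit lines. Thus the qubits may be identified with the 2-element subsets of $\{0,\dots,d\}$, qubit line $a$ being the set of all 2-subsets containing $a$. A $k$-line is the symmetric difference of $k$ distinct qubit lines (the symmetric difference of all $d+1$ qubit lines is empty). The stabilizer group is generated by $n-d$ independent products of Pauli-$Z$ operators. A product of Pauli-$X$ operators over a set of qubits commutes with all stabilizers exactly when the set is empty or a $k$-line for some $k$. The nonempty such sets act as nontrivial logical operators. Noise and decoding: only bit-flip (Pauli-$X$) errors are considered; an error is a set $\mathcal{E}$ of flipped qubits. The syndrome of $\mathcal{E}$ is the set of stabilizer generators that anticommute with it. Two sets $\mathcal{E},\mathcal{C}$ of qubits have the same syndrome if and only if their symmetric difference $\mathcal{E}\triangle\mathcal{C}$ is empty or a $k$-line. A decoder maps each syndrome to a correction $\mathcal{C}$, a set of qubits compatible with (having) that syndrome. It fails on $\mathcal{E}$ if $\mathcal{C}\neq\mathcal{E}$,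 equivalently if $\mathcal{E}\triangle\mathcal{C}$ is a nonempty $k$-line, i.e. a logical error results. The optimal decoder returns a correction of minimum cardinality among all corrections compatible with the syndrome (ties broken arbitrarily). The code-capacity threshold is the largest value such that for every physical error rate $p$ below it, under independent identically distributed bit flips and noiseless measurements, the failure probability tends to $0$ as $d\to\infty$. *)

(* Defs.v *)
From mathcomp Require Import all_boot all_order all_algebra.
From mathcomp Require Import all_classical all_reals all_analysis.

Set Implicit Arguments.
Unset Strict Implicit.
Unset Printing Implicit Defensive.

Import Order.TTheory GRing.Theory Num.Theory.
Import numFieldNormedType.Exports.

Local Open Scope classical_set_scope.
Local Open Scope ring_scope.

Definition qubit (d : nat) : Type := {e : {set 'I_d.+1} | #|e| == 2%N}.

Definition n_qubits (d : nat) : nat := ((d * d.+1) %/ 2)%N.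

Definition qubit_line (d : nat) (a : 'I_d.+1) : {set qubit d} :=
  [set e : qubit d | a \in val e].

Definition symdiff (T : finType) (A B : {set T}) : {set T} :=
  (A :\: B) :|: (B :\: A).

Definition is_kline (d k : nat) (L : {set qubit d}) : Prop :=
  exists2 A : {set 'I_d.+1}, #|A| = k &
    L = \big[@symdiff (qubit d)/finset.set0]_(a in A) qubit_line a.

(* A product of Pauli-X (or Pauli-Z) operators is represented by its support;
   X on [E] and Z on [S] anticommute iff the supports overlap in an odd number
   of qubits. *)
Definition anticommute (d : nat) (E S : {set qubit d}) : bool :=
  odd #|E :&: S|.

(* [stabilizers] is the set of supports of the chosen Z-type generators; the
   product of Z operators has the symmetric difference of supports as support. *)
Record parity_code (d : nat) := ParityCode {
  stabilizers : {set {set qubit d}};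
  card_stabilizers : #|stabilizers| = (n_qubits d - d)%N;
  stabilizers_independent : forall G : {set {set qubit d}},
    G \subset stabilizers -> G != finset.set0 ->
    \big[@symdiff (qubit d)/finset.set0]_(S in G) S != finset.set0;
  commute_stabilizers : forall E : {set qubit d},
    (forall S, S \in stabilizers -> ~~ anticommute E S) <->
    (E = finset.set0 \/ exists k : nat, is_kline k E) }.

Definition syndrome (d : nat) (C : parity_code d) (E : {set qubit d}) :
    {set {set qubit d}} :=
  [set S in stabilizers C | anticommute E S].

(* The value of [dec] at a set of generators that is not the syndrome of any
   error is irrelevant. *)
Definition is_decoder (d : nat) (C : parity_code d)
    (dec : {set {set qubit d}} -> {set qubit d}) : Prop :=
  forall E, syndrome C (dec (syndrome C E)) = syndrome C E.

Definition is_optimal_decoder (d : nat) (C : parity_code d)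
    (dec : {set {set qubit d}} -> {set qubit d}) : Prop :=
  is_decoder C dec /\
  forall E F, syndrome C F = syndrome C E ->
    (#|dec (syndrome C E)| <= #|F|)%N.

Definition bitflip_prob (R : realType) (d : nat) (p : R) (E : {set qubit d}) : R :=
  \prod_(e : qubit d) (if e \in E then p else 1 - p).

Definition P_fail (R : realType) (d : nat) (C : parity_code d)
    (dec : {set {set qubit d}} -> {set qubit d}) (p : R) : R :=
  \sum_(E : {set qubit d} | dec (syndrome C E) != E) bitflip_prob p E.

Definition code_capacity_threshold (R : realType) (Pf : nat -> R -> R) : R :=
  sup [set q : R | 0 <= q <= 1 /\
    forall p : R, 0 <= p < q -> Pf d p @[d --> \oo] --> (0 : R)].

(* Main.v *)
(* Identify the qubits with the edges of the complete graph on [N = d + 1]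
   vertices; the logical operators are then the nonempty edge cuts.  If the
   optimal decoder fails, at least half of the edges of some cut of a vertex set
   of size [k], [0 < k <= N / 2], are flipped.  Such a cut has [k (N - k)], hence
   at least [k N / 2], edges, so for [p < 1/2] this has probability at most
   [b ^ (k N / 2)] for a constant [b < 1], and a union bound over the vertex sets
   gives [P_fail <= (1 + s ^ N) ^ N - 1 -> 0] with [s ^ 2 = b].  At [p = 1/2] all
   errors are equiprobable and of two errors differing by a qubit line at most
   one is corrected, so [P_fail >= 1/2]. *)
Require Import Defs.
From mathcomp Require Import all_boot all_order all_algebra.
From mathcomp Require Import all_classical all_reals all_analysis.
From mathcomp Require Import zify ring lra.

Local Open Scope ring_scope.

Import Order.TTheory GRing.Theory Num.Theory.
Import numFieldNormedType.Exports.

Set Implicit Arguments.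
Unset Strict Implicit.
Unset Printing Implicit Defensive.

(** * Symmetric differences and parity of cardinals *)

Section SymDiff.
Variable T : finType.
Implicit Types (x : T) (A B E F S : {set T}).

Lemma in_symdiff A B x : (x \in symdiff A B) = (x \in A) (+) (x \in B).
Proof. by rewrite !inE; case: (x \in A); case: (x \in B). Qed.

Lemma symdiffK A B : symdiff (symdiff A B) B = A.
Proof. by apply/setP => x; rewrite !in_symdiff addbK. Qed.

Lemma symdiffKl A B : symdiff A (symdiff A B) = B.
Proof. by apply/setP => x; rewrite !in_symdiff addKb. Qed.

Lemma symdiff0_eq A B : symdiff A B = finset.set0 -> A = B.
Proof.
by move=> e; rewrite -(symdiffKl A B) e; apply/setP => x; rewrite in_symdiff inE addbF.
Qed.

Lemma odd_card A : odd #|A| = \big[addb/false]_x (x \in A).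
Proof.
rewrite -sum1_card (big_morph odd oddD (erefl : odd 0 = false)) big_mkcond.
by apply: eq_bigr => x _; case: (x \in A).
Qed.

Lemma odd_card_symdiffI A B S :
  odd #|symdiff A B :&: S| = odd #|A :&: S| (+) odd #|B :&: S|.
Proof.
rewrite !odd_card -big_split; apply: eq_bigr => x _ /=.
by rewrite !finset.in_setI in_symdiff andb_addl.
Qed.

(** Removing [E :&: F] from both sets preserves the comparison of sizes. With [E] the error and [F]
    a minimum correction, at least half of the logical operator [symdiff E F] is flipped. *)
Lemma leq_card_symdiff E F : (#|F| <= #|E|)%N ->
  (#|symdiff E F :\: E| <= #|symdiff E F :&: E|)%N.
Proof.
move=> leFE.
have -> : symdiff E F :\: E = F :\: E.
  by apply/setP => x; rewrite !inE; case: (x \in E); case: (x \in F).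
have -> : symdiff E F :&: E = E :\: F.
  by apply/setP => x; rewrite !inE; case: (x \in E); case: (x \in F).
move: leFE; rewrite -(cardsID E F) -(cardsID F E) finset.setIC.
by rewrite leq_add2l.
Qed.

End SymDiff.

(** * Edge cuts of the complete graph and their relation to syndromes *)

Section Cuts.
Variable d : nat.
Implicit Types (A : {set 'I_d.+1}) (e : qubit d).

(* The physical qubits are the edges of the complete graph on the qubit lines,
   and the [k]-lines are exactly its edge cuts. *)
Definition cut A : {set qubit d} := [set e | odd #|A :&: val e|].

Lemma big_qubit_line A :
  \big[@symdiff (qubit d)/finset.set0]_(a in A) qubit_line a = cut A.
Proof.
apply/setP => e.
rewrite (big_morph (fun B : {set qubit d} => e \in B)
  (fun B B' => in_symdiff B B' e) (finset.in_set0 e)).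
rewrite inE odd_card big_mkcond; apply: eq_bigr => a _.
by rewrite finset.in_setI; case: (a \in A); rewrite ?inE.
Qed.

Lemma cut0 : cut finset.set0 = finset.set0.
Proof. by apply/setP => e; rewrite !inE finset.set0I cards0. Qed.

(** An edge has two ends, so the numbers of its ends in [A] and in [~: A] have the same parity. *)
Lemma cutC A : cut (~: A) = cut A.
Proof.
apply/setP => e; rewrite !inE.
have := cardsID A (val e); rewrite (eqP (valP e)) finset.setIC.
rewrite finset.setDE [val e :&: _]finset.setIC => /(congr1 odd).
by rewrite oddD /=; case: odd; case: odd.
Qed.

(** A pair [(a, b)] in [A] times [~: A] gives the cut edge joining [a] and [b], which determines the
    pair since only [a] lies in [A]. *)
Lemma leq_card_cut A : (#|A| * #|~: A| <= #|cut A|)%N.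
Proof.
rewrite -cardsX -(card_imset (mem (cut A)) val_inj).
pose f (x : 'I_d.+1 * 'I_d.+1) := [set x.1; x.2].
have f_inj : {in finset.setX A (~: A) &, injective f}.
  move=> [a b] [a' b']; rewrite !finset.in_setX !inE /= => /andP[aA bA].
  move=> /andP[a'A b'A] /setP eqf.
  have := eqf a; rewrite !inE eqxx /= => /esym /orP[]/eqP ea; last first.
    by rewrite ea (negbTE b'A) in aA.
  have := eqf b; rewrite !inE eqxx orbT => /esym /orP[]/eqP eb.
    by rewrite eb a'A in bA.
  by rewrite ea eb.
rewrite -(card_in_imset f_inj).
apply/subset_leq_card/fintype.subsetP => _ /imsetP[[a b] + ->].
rewrite finset.in_setX inE /= => /andP[aA bA].
have ab : a != b by apply: contraNneq bA => <-.
have card_ab : #|f (a, b)| == 2%N by rewrite cards2 ab.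
apply/imsetP; exists (Sub (f (a, b)) card_ab) => //.
rewrite inE /= -(_ : [set a] = A :&: f (a, b)) ?cards1 //.
apply/setP => x; rewrite !inE; case: (eqVneq x a) => [->|_] /=; first by rewrite aA.
by case: eqP => [->|_]; rewrite ?andbF ?andbT ?(negbTE bA).
Qed.

(** Anticommutation with a fixed generator is additive in the error, so equal syndromes mean that
    the difference commutes with all generators. The empty set is the cut of [finset.set0], so cuts
    cover both cases of [commute_stabilizers]. *)
Lemma syndrome_eq (C : parity_code d) (E F : {set qubit d}) :
  syndrome C E = syndrome C F <-> exists A, symdiff E F = cut A.
Proof.
have -> : (exists A, symdiff E F = cut A) <->
    (symdiff E F = finset.set0 \/ exists k, is_kline k (symdiff E F)).
  split=> [[A ->]|[->|[k [A _ ->]]]].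
  - by right; exists #|A|, A; rewrite ?big_qubit_line.
  - by exists finset.set0; rewrite cut0.
  - by exists A; rewrite big_qubit_line.
rewrite -(commute_stabilizers C) /anticommute; split=> [/setP eqs S inS | comm].
  have := eqs S; rewrite !inE inS /= /anticommute odd_card_symdiffI => ->.
  by rewrite addbb.
apply/setP => S; rewrite !inE; case inS: (S \in stabilizers C) => //=.
by have := comm S inS; rewrite odd_card_symdiffI negb_add => /eqP.
Qed.

End Cuts.

(** * Sums over random subsets and a Chernoff-type bound *)

Section Probability.
Variable R : realType.

Lemma sum_bernoulli (T : finType) (p : R) :
  \sum_(E : {set T}) \prod_e (if e \in E then p else 1 - p) = 1.
Proof.
transitivity (\prod_(e : T) (p + (1 - p))); first by rewrite bigA_distr.
by apply: big1 => e _; rewrite addrC subrK.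
Qed.

Lemma sum_expr_card (T : finType) (x : R) :
  \sum_(A : {set T}) x ^+ #|A| = (1 + x) ^+ #|T|.
Proof.
rewrite -prodr_const (eq_bigl xpredT) //.
rewrite [RHS](eq_bigr (fun=> x + 1)); last by move=> *; rewrite addrC.
rewrite bigA_distr; apply: eq_bigr => A _.
by rewrite -big_mkcond /= prodr_const.
Qed.

(* Markov's inequality for [t ^ (#|L :&: E| - #|L :\: E|)] with [t = 2 (1 - p)],
   a choice for which [p t + (1 - p) / t < 1] also when [p = 0]. *)
Lemma majority_flip_le (T : finType) (L : {set T}) (p : R) : 0 <= p < 1 / 2 ->
  \sum_(E : {set T} | (#|L :\: E| <= #|L :&: E|)%N)
     \prod_e (if e \in E then p else 1 - p) <= (2 * p * (1 - p) + 1 / 2) ^+ #|L|.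
Proof.
move=> /andP[p0 p12]; pose t := 2 * (1 - p).
have t1 : 1 <= t by rewrite /t; lra.
have t0 : 0 < t by lra.
pose F e := p * (if e \in L then t else 1).
pose G e := (1 - p) * (if e \in L then t^-1 else 1).
have F0 e : 0 <= F e by rewrite /F; case: ifP => _; rewrite mulr_ge0 // ltW.
have G0 e : 0 <= G e.
  by rewrite /G; case: ifP => _; rewrite mulr_ge0 ?invr_ge0 //; lra.
apply: (@le_trans _ _ (\sum_(E : {set T}) \prod_e (if e \in E then F e else G e))).
  rewrite big_mkcond /=; apply: ler_sum => E _; case: ifP => [maj|_]; last first.
    by apply: prodr_ge0 => e _; case: ifP.
  have -> : \prod_e (if e \in E then F e else G e) =
     (\prod_e (if e \in E then p else 1 - p)) *
     (t ^+ #|L :&: E| * t^-1 ^+ #|L :\: E|).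
    rewrite -!prodr_const [X in _ * (X * _)]big_mkcond [X in _ * (_ * X)]big_mkcond /=.
    rewrite -!big_split /=; apply: eq_bigr => e _; rewrite !inE /F /G.
    by case: (e \in E); case: (e \in L); rewrite /= ?mulr1 ?mul1r.
  rewrite ler_peMr //.
    by apply: prodr_ge0 => e _; case: ifP => _; lra.
  rewrite exprVn ler_pdivlMr ?exprn_gt0 // mul1r.
  exact: ler_weXn2l.
(* The sum factors over qubits: each qubit of [L] contributes [p * t + (1 - p) / t = 2 * p * (1 - p)
   + 1 / 2], any other contributes [1]. *)
rewrite -bigA_distr -prodr_const [leRHS]big_mkcond /= le_eqVlt; apply/orP; left.
apply/eqP/eq_bigr => e _; rewrite /F /G; case: ifP => _; last by rewrite !mulr1; lra.
by rewrite /t; field; lra.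
Qed.

End Probability.

(** * Upper and lower bounds on the failure probability *)

Section ParityCode.
Variables (R : realType) (d : nat) (C : parity_code d).
Variable dec : {set {set qubit d}} -> {set qubit d}.

Lemma bitflip_prob_ge0 (p : R) (E : {set qubit d}) :
  0 <= p <= 1 -> 0 <= bitflip_prob p E.
Proof. by move=> p01; apply: prodr_ge0 => e _; case: ifP => _; lra. Qed.

Lemma P_fail_ge0 (p : R) : 0 <= p <= 1 -> 0 <= P_fail C dec p.
Proof. by move=> p01; apply: sumr_ge0 => E _; exact: bitflip_prob_ge0. Qed.

Lemma optimal_decoder_fail (E : {set qubit d}) :
  is_optimal_decoder C dec -> dec (syndrome C E) != E ->
  exists A : {set 'I_d.+1}, [/\ A != finset.set0, (#|A|.*2 <= d.+1)%N &
    (#|cut A :\: E| <= #|cut A :&: E|)%N].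
Proof.
move=> [is_dec opt] fail; set F := dec (syndrome C E) in fail.
have /syndrome_eq[A cutA] : syndrome C E = syndrome C F by rewrite is_dec.
have maj := leq_card_symdiff (opt E E erefl); rewrite -/F cutA in maj.
have cutA_neq0 : cut A != finset.set0.
  by apply: contra_neq fail => cut0; rewrite cut0 in cutA; rewrite (symdiff0_eq cutA).
have : (#|A| + #|~: A| = d.+1)%N by rewrite cardsC card_ord.
(* [A] and its complement have the same cut; take the one with at most half of the vertices. *)
have [small sumA|big sumA] := leqP #|A|.*2 d.+1.
  exists A; split=> //.
  by apply: contra_neq cutA_neq0 => ->; rewrite cut0.
exists (~: A); rewrite cutC; split=> //; last by lia.
by apply: contra_neq cutA_neq0; rewrite -(cutC A) => ->; rewrite cut0.
Qed.

Lemma P_fail_le (p s : R) : is_optimal_decoder C dec ->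
  0 <= p < 1 / 2 -> 0 <= s <= 1 -> 2 * p * (1 - p) + 1 / 2 = s ^+ 2 ->
  P_fail C dec p <= (1 + s ^+ d.+1) ^+ d.+1 - 1.
Proof.
move=> opt p12 /andP[s0 s1] sE.
have P0 (E : {set qubit d}) : 0 <= bitflip_prob p E.
  by apply: bitflip_prob_ge0; lra.
pose small (A : {set 'I_d.+1}) := (A != finset.set0) && (#|A|.*2 <= d.+1)%N.
pose maj (A : {set 'I_d.+1}) (E : {set qubit d}) :=
  (#|cut A :\: E| <= #|cut A :&: E|)%N.
apply: (@le_trans _ _ (\sum_(A | small A) \sum_(E | maj A E) bitflip_prob p E)).
  rewrite (exchange_big_dep xpredT) //= /P_fail big_mkcond /=.
  apply: ler_sum => E _; case: ifP => [|_]; last exact: sumr_ge0.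
  move=> /(optimal_decoder_fail opt)[A [A0 A2 AE]].
  rewrite (bigD1 A) /=; last by rewrite /small A0 A2.
  by rewrite lerDl sumr_ge0.
apply: (@le_trans _ _ (\sum_(A | small A) (s ^+ d.+1) ^+ #|A|)).
  apply: ler_sum => A /andP[A0 A2].
  apply: le_trans (majority_flip_le (cut A) p12) _.
  (* As [s <= 1], it suffices that [d.+1 * #|A| <= 2 * #|cut A|], which follows from
     [d.+1 <= 2 * #|~: A|]. *)
  rewrite sE -!exprM; apply: ler_wiXn2l => //.
  have := leq_card_cut A.
  have : (#|A| + #|~: A| = d.+1)%N by rewrite cardsC card_ord.
  by move: A2; nia.
have := sum_expr_card 'I_d.+1 (s ^+ d.+1); rewrite card_ord => <-.
(* The empty vertex set contributes the [1] that is subtracted. *)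
rewrite [X in _ <= X - _](bigD1 finset.set0) //= cards0 expr0 addrC addrK.
rewrite [leLHS]big_mkcond [leRHS]big_mkcond /=; apply: ler_sum => A _.
rewrite /small; case: eqP => //= _; case: ifP => // _.
by rewrite !exprn_ge0.
Qed.

Lemma P_fail_half_ge : (0 < d)%N -> 1 / 2 <= P_fail C dec (1 / 2 : R).
Proof.
move=> d0; pose c : R := (1 / 2) ^+ #|{: qubit d}|.
have PE (E : {set qubit d}) : bitflip_prob (1 / 2) E = c.
  rewrite /c -prodr_const; apply: eq_big => // e _.
  by case: ifP => _ //; lra.
have c0 : 0 <= c by rewrite exprn_ge0 //; lra.
pose L := cut [set ord0 : 'I_d.+1].
have L0 : L != finset.set0.
  rewrite -card_gt0; apply: leq_trans (leq_card_cut _).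
  by rewrite cards1 mul1n cardsC1 card_ord.
pose fail E := dec (syndrome C E) != E.
have := sum_bernoulli (qubit d) (1 / 2 : R).
rewrite (bigID fail) /=.
suff : \sum_(E | ~~ fail E) bitflip_prob (1 / 2 : R) E <= P_fail C dec (1 / 2).
  by rewrite /P_fail /bitflip_prob /fail; lra.
(* Adding the qubit line [L] keeps the syndrome, so this involution sends every corrected error to a
   failing one. *)
have invol : involutive (fun E => symdiff E L) by move=> E; exact: symdiffK.
rewrite /P_fail (reindex_inj (inv_inj invol)) big_mkcond [leRHS]big_mkcond /=.
apply: ler_sum => E _; rewrite !PE; case: ifP => [|_]; last by case: ifP.
rewrite negbK => /eqP; case: ifP => // /negbFE/eqP decE.
have -> : syndrome C (symdiff E L) = syndrome C E.
  by apply/esym/syndrome_eq; exists [set ord0]; rewrite symdiffKl.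
rewrite decE => eqE; case/eqP: L0; rewrite -(symdiffKl E L) -eqE.
by apply/setP => e; rewrite in_symdiff addbb inE.
Qed.

End ParityCode.

(** * The union bound tends to zero *)

Section Limit.
Variable R : realType.

(** Each of the first [n] terms of the geometric series of ratio [r] is at least [r ^+ n]. *)
Lemma natrX_le_geometric (r : R) n : 0 <= r < 1 -> r ^+ n *+ n <= (1 - r)^-1.
Proof.
move=> /andP[r0 r1]; apply: (@le_trans _ _ (\sum_(i < n) r ^+ i)).
  rewrite -[X in _ *+ X](card_ord n) -sumr_const.
  apply: ler_sum => i _; apply: ler_wiXn2l => //; first exact: ltW.
  exact: ltnW (ltn_ord i).
rewrite -[leRHS]mul1r ler_pdivlMr ?subr_gt0 // mulrC -opprB mulNr -subrX1 opprB.
by rewrite lerBlDr lerDl exprn_ge0.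
Qed.

(** With [s = r ^+ 2], the power is at most the exponential of [n * s ^+ n = (n * r ^+ n) * r ^+ n],
    whose first factor is bounded by [(1 - r)^-1]. *)
Lemma cvg_expr1D_expr (s : R) : 0 <= s < 1 ->
  ((1 + s ^+ n) ^+ n - 1 @[n --> \oo] --> (0 : R))%classic.
Proof.
move=> /andP[s0 s1]; pose r := Num.sqrt s.
have r0 : 0 <= r by exact: sqrtr_ge0.
have r1 : r < 1 by rewrite -sqrtr1 ltr_sqrt.
have sE : s = r ^+ 2 by rewrite sqr_sqrtr.
have bound : (expR ((1 - r)^-1 * r ^+ n) - 1 @[n --> \oo] --> (0 : R))%classic.
  have -> : 0 = expR ((1 - r)^-1 * 0) - 1 :> R by rewrite mulr0 expR0 subrr.
  apply: cvgB; last exact: cvg_cst.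
  apply: continuous_cvg; first exact: continuous_expR.
  apply: cvgM; first exact: cvg_cst.
  by apply: cvg_expr; rewrite ger0_norm.
apply: squeeze_cvgr (cvg_cst (0 : R)) bound; apply: nearW => n; apply/andP; split.
  by rewrite subr_ge0 exprn_ege1 // lerDl exprn_ge0.
rewrite lerD2r.
apply: (@le_trans _ _ (expR (s ^+ n) ^+ n)).
  by apply: lerXn2r; rewrite ?nnegrE ?expR_ge0 ?expR_ge1Dx // addr_ge0 ?exprn_ge0.
rewrite -expRM_natl ler_expR sE -exprM mulnC exprM expr2 mulrA.
rewrite ler_wpM2r ?exprn_ge0 // mulr_natl.
by apply: natrX_le_geometric; rewrite r0.
Qed.

End Limit.

Theorem lemma2 (R : realType) (C : forall d : nat, parity_code d)
    (dec : forall d : nat, {set {set qubit d}} -> {set qubit d})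
    (hdec : forall d : nat, is_optimal_decoder (C d) (dec d)) :
  code_capacity_threshold (fun (d : nat) (p : R) => P_fail (C d) (dec d) p)
  = 1 / 2.
Proof.
rewrite /code_capacity_threshold; set Q := (X in sup X).
have ubQ : ubound Q (1 / 2).
  move=> q [/andP[q0 q1] cvgQ]; rewrite leNgt; apply/negP => q12.
  have h12 : 0 <= 1 / 2 :> R by lra.
  (* If [q] exceeded [1 / 2], failure would vanish at [p = 1 / 2], where it is at least [1 / 2] for
     all [d > 0]. *)
  have cvg12 := cvgQ _ (introT andP (conj h12 q12)).
  have : 1 / 2 <= (0 : R).
    apply: (cvgr_to_ge cvg12); near=> d; apply: P_fail_half_ge.
    by near: d; exact: nbhs_infty_gt.
  lra.
have Q12 : Q (1 / 2).
  split=> [|p p12]; first by lra.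
  pose b : R := 2 * p * (1 - p) + 1 / 2.
  have b01 : 0 <= b < 1.
    have /andP[p0 pl] := p12.
    have pq0 : 0 <= p * (1 - p) by apply: mulr_ge0; lra.
    (* This gives [b < 1], because [b = 1 - (1 - 2 * p) ^+ 2 / 2]. *)
    have sq0 : 0 < (1 - 2 * p) ^+ 2 by rewrite exprn_gt0 //; lra.
    by apply/andP; split; rewrite /b; move: pq0 sq0; [lra | nra].
  pose s := Num.sqrt b.
  have s0 : 0 <= s by exact: sqrtr_ge0.
  have s1 : s < 1 by have /andP[_ ?] := b01; rewrite -sqrtr1 ltr_sqrt.
  have sE : b = s ^+ 2 by rewrite sqr_sqrtr //; have /andP[] := b01.
  have s01 : 0 <= s < 1 by rewrite s0.
  (* The bound is in terms of the number [d.+1] of vertices, hence the shift. *)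
  have := cvg_expr1D_expr s01; rewrite -cvg_shiftS /= => lim.
  apply: squeeze_cvgr (cvg_cst (0 : R)) lim; apply: nearW => d; apply/andP; split.
    by apply: P_fail_ge0; lra.
  by apply: P_fail_le => //; rewrite s0 ltW.
apply/eqP; rewrite eq_le; apply/andP; split.
  by apply: ge_sup ubQ; exists (1 / 2).
by apply: ub_le_sup Q12; exists (1 / 2).
Unshelve. all: by end_near.
Qed.
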